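(* Let $n\ge 2$ and let $A\in\mathbb{R}^{n\times n}$ be oscillatory, with successive elementary bidiagonal factorization $A=LDU$, where $L=W_2W_3\cdots W_n$ is the product of all the lower factors and $U=Q_nQ_{n-1}\cdots Q_2$ is the product of all the upper factors. Then \[ r(A)=\max\{\,r_\ell(L),\; r_u(U)\,\}. \]
   Context: A real matrix is totally positive (TP) [totally nonnegative (TN)] if all its minors are positive [nonnegative]. $A\in\mathbb{R}^{n\times n}$ is oscillatory if it is TN and $A^k$ is TP for some positive integer $k$; the exponent $r(A)$ is the least such $k$. For $i\in\{2,\dots,n\}$, $q\in\mathbb{R}$: $L_i(q):=I+qE_{i,i-1}$, $U_i(q):=L_i(q)^T$, where $E_{i,j}$ has a single nonzero entry $1$ at $(i,j)$. Every invertible TN matrix $A\in\mathbb{R}^{n\times n}$ has a unique successive elementary bidiagonal (SEB) factorization $A=W_2W_3\cdots W_n\,D\,Q_nQ_{n-1}\cdots Q_2$, where $D$ is diagonal with positive diagonal entries, and for each $i\in\{2,\dots,n\}$, $W_i=L_n(a_n)L_{n-1}(a_{n-1})\cdots L_i(a_i)$ and $Q_i=U_i(b_i)U_{i+1}(b_{i+1})\cdots U_n(b_n)$ with all multipliers $a_j,b_j\ge0$ (the multipliers depending on $i$). For a matrix $M\in\mathbb{R}^{n\times n}$ the lower-left corner minors are $M(\{n-c+1,\dots,n\}|\{1,\dots,c\})$ and the upper-right corner minors are $M(\{1,\dots,c\}|\{n-c+1,\dots,n\})$, $c=1,\dots,n$, where $M(\alpha|\beta)$ is the determinant of the submatrix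 with rows $\alpha$ and columns $\beta$. $r_\ell(M)$ is the least positive integer $w$ such that all lower-left corner minors of $M^w$ with $c\in\{1,\dots,n-1\}$ (i.e., except possibly the determinant) are positive; $r_u(M)$ is the least positive integer $v$ such that all upper-right corner minors of $M^v$ with $c\in\{1,\dots,n-1\}$ are positive. *)

(* Defs.v *)
From HB Require Import structures.
From mathcomp Require Import all_boot all_order all_algebra.
From mathcomp Require Import reals.

Set Implicit Arguments.
Unset Strict Implicit.
Unset Printing Implicit Defensive.

Import Order.TTheory GRing.Theory Num.Theory.
Local Open Scope ring_scope.

Section Minors.
Variables (R : realType) (n : nat).
Implicit Types (A M : 'M[R]_n).

Definition increasing k (f : 'I_k -> 'I_n) : Prop :=
  forall i j : 'I_k, (i < j)%N -> (f i < f j)%N.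

(* A k-element index set is represented by its increasing enumeration
   'I_k -> 'I_n. *)
Definition minor k (f g : 'I_k -> 'I_n) M : R := \det (mxsub f g M).

Definition totally_positive M : Prop :=
  forall k (f g : 'I_k -> 'I_n), (0 < k)%N ->
    increasing f -> increasing g -> 0 < minor f g M.

Definition totally_nonnegative M : Prop :=
  forall k (f g : 'I_k -> 'I_n), (0 < k)%N ->
    increasing f -> increasing g -> 0 <= minor f g M.

Definition oscillatory A : Prop :=
  totally_nonnegative A /\
  exists k : nat, (0 < k)%N /\ totally_positive (A ^+ k).

Definition first_ord c (hc : (c <= n)%N) : 'I_c -> 'I_n := widen_ord hc.

Lemma last_ord_subproof c (hc : (c <= n)%N) (i : 'I_c) : (n - c + i < n)%N.
Proof. by rewrite -[ltnRHS](subnK hc) ltn_add2l. Qed.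

Definition last_ord c (hc : (c <= n)%N) (i : 'I_c) : 'I_n :=
  Ordinal (last_ord_subproof hc i).

Definition lower_left_minor c (hc : (c <= n)%N) M : R :=
  minor (last_ord hc) (first_ord hc) M.

Definition upper_right_minor c (hc : (c <= n)%N) M : R :=
  minor (first_ord hc) (last_ord hc) M.

Definition least_positive (P : nat -> Prop) (k : nat) : Prop :=
  [/\ (0 < k)%N, P k & forall j : nat, (0 < j)%N -> P j -> (k <= j)%N].

(* The exponents are graphs of partial functions: "is_exponent A r" says that
   r(A) is defined and equal to r, and similarly for r_l and r_u. *)
Definition is_exponent A (r : nat) : Prop :=
  least_positive (fun k => totally_positive (A ^+ k)) r.

Definition is_lower_exponent M (w : nat) : Prop :=
  least_positive (fun k => forall c (hc : (c <= n)%N), (0 < c < n)%N ->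
    0 < lower_left_minor hc (M ^+ k)) w.

Definition is_upper_exponent M (v : nat) : Prop :=
  least_positive (fun k => forall c (hc : (c <= n)%N), (0 < c < n)%N ->
    0 < upper_right_minor hc (M ^+ k)) v.

End Minors.

(* In this section matrix indices i, j are 1-based natural numbers. *)
Section SEB.
Variables (R : realType) (n : nat).

Definition unit_mx (i j : nat) : 'M[R]_n :=
  \matrix_(r, s) ((r.+1 == i) && (s.+1 == j))%:R.

Definition L_mx (i : nat) (q : R) : 'M[R]_n := 1%:M + q *: unit_mx i i.-1.
Definition U_mx (i : nat) (q : R) : 'M[R]_n := (L_mx i q)^T.

(* The multiplier of L_j in W_i is a i j, that of U_j in Q_i is b i j; only
   the values with 2 <= i <= j <= n are used. *)
Definition W_mx (a : nat -> nat -> R) (i : nat) : 'M[R]_n :=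
  \prod_(j <- rev (index_iota i n.+1)) L_mx j (a i j).

Definition Q_mx (b : nat -> nat -> R) (i : nat) : 'M[R]_n :=
  \prod_(i <= j < n.+1) U_mx j (b i j).

Definition SEB_lower (a : nat -> nat -> R) : 'M[R]_n :=
  \prod_(2 <= i < n.+1) W_mx a i.

Definition SEB_upper (b : nat -> nat -> R) : 'M[R]_n :=
  \prod_(i <- rev (index_iota 2 n.+1)) Q_mx b i.

Definition SEB_factorization (A : 'M[R]_n)
    (a : nat -> nat -> R) (d : 'rV[R]_n) (b : nat -> nat -> R) : Prop :=
  [/\ forall i j, (2 <= i)%N -> (i <= j)%N -> (j <= n)%N -> 0 <= a i j,
      forall i j, (2 <= i)%N -> (i <= j)%N -> (j <= n)%N -> 0 <= b i j,
      forall k, 0 < d 0 k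
    & A = SEB_lower a *m diag_mx d *m SEB_upper b].

End SEB.

(* Main.v *)
Require Import Defs.
From HB Require Import structures.
From mathcomp Require Import all_boot all_order all_algebra.
From mathcomp Require Import reals boolp zify.

Set Implicit Arguments.
Unset Strict Implicit.
Unset Printing Implicit Defensive.

Import Order.TTheory GRing.Theory Num.Theory.
Local Open Scope ring_scope.

(* For a matrix M with nonnegative minors consider, on increasing index maps, the
   relation "the minor of M with rows f and columns g is positive". For diagonal
   and elementary bidiagonal matrices it is reflexive and closed under pointwise
   minima and maxima, and multiplying matrices composes the relations; hence all
   this holds for A, L, U and their powers.
   Positive corner minors first -> last and last -> first then force every minor
   to be positive: taking maxima with f -> f and g -> g yields f -> last and
   last -> g, and the minimum of these two is f -> g.
   The relation of L only lowers indices and that of D U only raises them, so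
   taking minima turns a chain last -> first for (L D U)^k into one for L^k. The
   converse holds by reflexivity, and U is handled dually. Thus A^k is totally
   positive iff the corner minors of both L^k and U^k are positive, a condition
   monotone in k. *)

(** * The lattice of increasing index maps *)

Section IndexSets.
Context {n : nat}.

Definition index_min {k} (f g : 'I_k -> 'I_n) (i : 'I_k) : 'I_n :=
  if (f i <= g i)%N then f i else g i.

Definition index_max {k} (f g : 'I_k -> 'I_n) (i : 'I_k) : 'I_n :=
  if (f i <= g i)%N then g i else f i.

Definition index_le {k} (f g : 'I_k -> 'I_n) := forall i, (f i <= g i)%N.

Definition index_upd {k} (f : 'I_k -> 'I_n) p y (i : 'I_k) : 'I_n :=
  if i == p then y else f i.

Lemma index_min_val k (f g : 'I_k -> 'I_n) i :
  index_min f g i = minn (f i) (g i) :> nat.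
Proof. by rewrite /index_min; case: ifP; lia. Qed.

Lemma index_max_val k (f g : 'I_k -> 'I_n) i :
  index_max f g i = maxn (f i) (g i) :> nat.
Proof. by rewrite /index_max; case: ifP; lia. Qed.

Lemma index_min_l k (f g : 'I_k -> 'I_n) : index_le f g -> index_min f g = f.
Proof. by move=> fg; apply/funext => i; rewrite /index_min fg. Qed.

Lemma index_min_r k (f g : 'I_k -> 'I_n) : index_le g f -> index_min f g = g.
Proof.
by move=> gf; apply/funext => i; apply/val_inj;
   move: (gf i) (index_min_val f g i) => /=; lia.
Qed.

Lemma index_max_l k (f g : 'I_k -> 'I_n) : index_le g f -> index_max f g = f.
Proof.
by move=> gf; apply/funext => i; apply/val_inj;
   move: (gf i) (index_max_val f g i) => /=; lia.
Qed.

Lemma index_max_r k (f g : 'I_k -> 'I_n) : index_le f g -> index_max f g = g.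
Proof. by move=> fg; apply/funext => i; rewrite /index_max fg. Qed.

Lemma increasing_min k (f g : 'I_k -> 'I_n) :
  increasing f -> increasing g -> increasing (index_min f g).
Proof.
by move=> hf hg i j ij; move: (hf i j ij) (hg i j ij);
   rewrite !index_min_val; lia.
Qed.

Lemma increasing_max k (f g : 'I_k -> 'I_n) :
  increasing f -> increasing g -> increasing (index_max f g).
Proof.
by move=> hf hg i j ij; move: (hf i j ij) (hg i j ij);
   rewrite !index_max_val; lia.
Qed.

Lemma increasing_inj k (f : 'I_k -> 'I_n) : increasing f -> injective f.
Proof.
move=> hf i j fij; apply/val_inj => /=.
case: (ltngtP i j) => // [/hf|/hf]; rewrite fij; lia.
Qed.

Lemma increasing_le k (f : 'I_k -> 'I_n) (i j : 'I_k) :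
  increasing f -> (f i < f j)%N -> (i < j)%N.
Proof.
move=> hf fij; case: (ltngtP i j) => // [/hf|/val_inj ij]; first lia.
by move: fij; rewrite ij; lia.
Qed.

Lemma increasing_ge_id k (f : 'I_k -> 'I_n) (i : 'I_k) : increasing f -> (i <= f i)%N.
Proof.
move=> hf; case: i => m; elim: m => [|m IHm] hm //=.
have /= := IHm (ltnW hm).
have /= := hf (Ordinal (ltnW hm)) (Ordinal hm) (ltnSn m); lia.
Qed.

Lemma increasing_le_last k (f : 'I_k -> 'I_n) (i : 'I_k) :
  increasing f -> (f i + k <= n + i)%N.
Proof.
move=> hf; case: i => m hm.
(* Downward induction on the position: [t] counts the positions after [m]. *)
have [t mt] : exists t, (m + t.+1 = k)%N by exists (k - m.+1)%N; lia.
elim: t m hm mt => [|t IHt] m hm mt.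
  by have /= := ltn_ord (f (Ordinal hm)); lia.
have hm1 : (m.+1 < k)%N by lia.
have /= := IHt m.+1 hm1 ltac:(lia).
have /= := hf (Ordinal hm) (Ordinal hm1) (ltnSn m); lia.
Qed.

End IndexSets.

(** Writing [f = g \o h], the map [h] is an increasing self-map of ['I_k]; the bounds [i <= h i] and
    [h i <= i] make it the identity. *)
Lemma increasing_sub_eq n k (f g : 'I_k -> 'I_n) :
  increasing f -> increasing g -> (forall i, exists j, f i = g j) -> f = g.
Proof.
move=> hf hg /choice[h fgh]; apply/funext => i.
have hh : increasing h by move=> p q /hf; rewrite !fgh => /(increasing_le hg).
have hi : h i = i.
  apply/val_inj; move: (increasing_ge_id i hh) (increasing_le_last i hh) => /=.
  by lia.
by rewrite fgh hi.
Qed.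

(** * Matrices with a reflexive, min- and max-closed relation of positive minors *)

Section Planar.
Variables (R : realType) (n : nat).
Implicit Types (M N : 'M[R]_n).

(** Unlike in [totally_nonnegative], the size 0 is allowed; the empty minor is 1. *)
Definition minors_ge0 M := forall k (f g : 'I_k -> 'I_n),
  increasing f -> increasing g -> 0 <= minor f g M.

(* planar_mul is the qualitative form of the Cauchy-Binet formula. *)
Record planar M : Prop := Planar {
  planar_refl : forall k (f : 'I_k -> 'I_n), increasing f -> 0 < minor f f M;
  planar_min : forall k (f g f' g' : 'I_k -> 'I_n),
    increasing f -> increasing g -> increasing f' -> increasing g' ->
    0 < minor f g M -> 0 < minor f' g' M ->
    0 < minor (index_min f f') (index_min g g') M;
  planar_max : forall k (f g f' g' : 'I_k -> 'I_n),
    increasing f -> increasing g -> increasing f' -> increasing g' ->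
    0 < minor f g M -> 0 < minor f' g' M ->
    0 < minor (index_max f f') (index_max g g') M;
  planar_ge0_mul : forall N, minors_ge0 N -> minors_ge0 (M *m N);
  planar_mul : forall N, minors_ge0 N -> forall k (f g : 'I_k -> 'I_n),
    increasing f -> increasing g ->
    0 < minor f g (M *m N) <->
    exists h, [/\ increasing h, 0 < minor f h M & 0 < minor h g N] }.

Lemma minor_1_refl k (f : 'I_k -> 'I_n) :
  increasing f -> minor f f (1%:M : 'M[R]_n) = 1.
Proof.
move=> hf; rewrite /minor -[RHS](det1 R k); congr (\det _).
by apply/matrixP => i j; rewrite !mxE (inj_eq (increasing_inj hf)).
Qed.

(** If some [f i] is not a value of [g], row [i] of the submatrix of the identity is zero; otherwise
    the image of [f] lies in that of [g]. *)
Lemma minor_1_neq0 k (f g : 'I_k -> 'I_n) :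
  increasing f -> increasing g -> minor f g (1%:M : 'M[R]_n) != 0 -> f = g.
Proof.
move=> hf hg fg; apply: increasing_sub_eq => // i.
have [/existsP[j /eqP ?]|/existsPn nj] := boolP [exists j, f i == g j].
  by exists j.
case/eqP: fg; rewrite /minor (expand_det_row _ i) big1 // => j _.
by rewrite !mxE (negPf (nj j)) mul0r.
Qed.

Lemma minors_ge0_1 : minors_ge0 1%:M.
Proof.
move=> k f g hf hg; have [->//|fg] := eqVneq (minor f g (1%:M : 'M[R]_n)) 0.
by rewrite (minor_1_neq0 hf hg fg) minor_1_refl.
Qed.

Lemma planar_ge0 M : planar M -> minors_ge0 M.
Proof. by move=> hM; rewrite -[M]mulmx1; exact: (planar_ge0_mul hM minors_ge0_1). Qed.

(** Reduces planarity to combinatorics: [step] is a candidate for the relation of positive minors,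
    and the last hypothesis is Cauchy-Binet for left multiplication by [M]. Its case [N = 1]
    identifies [step] with positivity of the minors of [M]. *)
Lemma planar_of_step M
    (step : forall k, ('I_k -> 'I_n) -> ('I_k -> 'I_n) -> Prop) :
  (forall k (f : 'I_k -> 'I_n), step k f f) ->
  (forall k (f g f' g' : 'I_k -> 'I_n), step k f g -> step k f' g' ->
     step k (index_min f f') (index_min g g')) ->
  (forall k (f g f' g' : 'I_k -> 'I_n), step k f g -> step k f' g' ->
     step k (index_max f f') (index_max g g')) ->
  (forall N, minors_ge0 N -> forall k (f g : 'I_k -> 'I_n),
     increasing f -> increasing g -> 0 <= minor f g (M *m N) /\
     (0 < minor f g (M *m N) <->
      exists h, [/\ increasing h, step k f h & 0 < minor h g N])) ->
  planar M /\ (forall k (f g : 'I_k -> 'I_n), increasing f -> increasing g ->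
     (0 < minor f g M <-> step k f g)).
Proof.
move=> srefl smin smax smul.
have E k (f g : 'I_k -> 'I_n) : increasing f -> increasing g ->
    (0 < minor f g M <-> step k f g).
  move=> hf hg; have [_] := smul _ minors_ge0_1 _ _ _ hf hg.
  rewrite mulmx1 => ->; split=> [[h [hh fh]]|fg]; last first.
    by exists g; rewrite minor_1_refl.
  by move=> /lt0r_neq0/minor_1_neq0 <-.
split=> //; split.
- by move=> k f hf; apply/E.
- move=> k f g f' g' hf hg hf' hg' /E fg /E fg'.
  by apply/E; [exact: increasing_min..|apply: smin; auto].
- move=> k f g f' g' hf hg hf' hg' /E fg /E fg'.
  by apply/E; [exact: increasing_max..|apply: smax; auto].
- by move=> N hN k f g hf hg; case: (smul _ hN _ _ _ hf hg).
- move=> N hN k f g hf hg; case: (smul _ hN _ _ _ hf hg) => _ ->.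
  by split=> -[h [hh fh hgN]]; exists h; split=> //; apply/E.
Qed.

(** * Diagonal matrices, products and powers *)

Lemma planar_diag (d : 'rV[R]_n) : (forall i, 0 < d 0 i) ->
  planar (diag_mx d) /\ (forall k (f g : 'I_k -> 'I_n),
     increasing f -> increasing g -> (0 < minor f g (diag_mx d) <-> f = g)).
Proof.
move=> d_gt0; apply: (@planar_of_step _ (fun k f g => f = g)) => //.
- by move=> k f g f' g' -> ->.
- by move=> k f g f' g' -> ->.
move=> N hN k f g hf hg.
(* Scaling rows multiplies the minor by a positive product, so the relation of a diagonal matrix is
   equality. *)
have -> : minor f g (diag_mx d *m N) = (\prod_i d 0 (f i)) * minor f g N.
  transitivity (\det (diag_mx (\row_i d 0 (f i)) *m mxsub f g N)).
    congr (\det _); apply/matrixP => i j.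
    by rewrite mxE mul_diag_mx mxE mul_diag_mx !mxE.
  by rewrite det_mulmx det_diag; congr (_ * _); apply: eq_bigr => i _; rewrite mxE.
have p_gt0 : 0 < \prod_i d 0 (f i) by apply: prodr_gt0.
rewrite pmulr_rge0 // pmulr_rgt0 //; split; first exact: hN.
by split=> [fg|[h [hh -> //]]]; exists f.
Qed.

Lemma planar_1 : planar 1%:M.
Proof.
rewrite -diag_const_mx.
by have [] := @planar_diag (const_mx 1) => [i|//]; rewrite mxE.
Qed.

(** Relations compose, and two composite steps are combined by taking the minimum or maximum of
    their intermediate maps as well. *)
Lemma planar_mulmx M N : planar M -> planar N -> planar (M *m N).
Proof.
move=> hM hN; have N0 := planar_ge0 hN.
split.
- by move=> k f hf; apply/planar_mul => //; exists f; split=> //; exact: planar_refl.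
- move=> k f g f' g' hf hg hf' hg' /planar_mul-/(_ hM N0 hf hg)[h [hh fh gh]].
  move=> /planar_mul-/(_ hM N0 hf' hg')[h' [hh' fh' gh']].
  apply/planar_mul; [by []|by []|exact: increasing_min..|].
  exists (index_min h h'); split; first exact: increasing_min.
    exact: planar_min.
  exact: planar_min.
- move=> k f g f' g' hf hg hf' hg' /planar_mul-/(_ hM N0 hf hg)[h [hh fh gh]].
  move=> /planar_mul-/(_ hM N0 hf' hg')[h' [hh' fh' gh']].
  apply/planar_mul; [by []|by []|exact: increasing_max..|].
  exists (index_max h h'); split; first exact: increasing_max.
    exact: planar_max.
  exact: planar_max.
- by move=> P P0; rewrite -mulmxA; do 2!apply: planar_ge0_mul => //.
move=> P P0 k f g hf hg; rewrite -mulmxA.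
have NP0 : minors_ge0 (N *m P) by exact: planar_ge0_mul.
split.
  move=> /planar_mul-/(_ hM NP0 hf hg)[h [hh fh]].
  move=> /planar_mul-/(_ hN P0 hh hg)[h' [hh' hh'N h'g]].
  exists h'; split=> //; apply/planar_mul => //; by exists h.
move=> [h' [hh' /planar_mul-/(_ hM N0 hf hh')[h [hh fh hh'N]] h'g]].
apply/planar_mul => //; exists h; split=> //; apply/planar_mul => //; by exists h'.
Qed.

Lemma planar_exp M k : planar M -> planar (M ^+ k).
Proof.
move=> hM; elim: k => [|k IHk]; first exact: planar_1.
by rewrite exprS; exact: planar_mulmx.
Qed.

(** * Elementary operations on adjacent rows *)

Lemma minor_addrow_notin k (f g : 'I_k -> 'I_n) x y (q : R) N :
  (forall i, f i != x) ->
  minor f g ((1%:M + q *: delta_mx x y) *m N) = minor f g N.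
Proof.
move=> fx; congr (\det _); apply/matrixP => i j.
rewrite mxE mulmxDl mul1mx -scalemxAl !mxE big1 ?mulr0 ?addr0 // => s _.
by rewrite !mxE (negPf (fx i)) mul0r.
Qed.

(** Multilinearity of the determinant in row [p]: the operation adds [q] times row [y] to row [f p]
    and, [f] being injective, affects no other row of the minor. *)
Lemma minor_addrow k (f g : 'I_k -> 'I_n) p y (q : R) N :
  increasing f ->
  minor f g ((1%:M + q *: delta_mx (f p) y) *m N) =
  minor f g N + q * minor (index_upd f p y) g N.
Proof.
move=> hf; rewrite -[X in _ = X + _]mul1r.
have E i j : ((1%:M + q *: delta_mx (f p) y) *m N) i j =
    N i j + q * ((i == f p)%:R * N y j).
  rewrite mulmxDl mul1mx -scalemxAl !mxE; congr (_ + _ * _).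
  rewrite (bigD1 y) //= !mxE eqxx andbT big1 ?addr0 // => s sy.
  by rewrite !mxE (negPf sy) andbF mul0r.
apply: (determinant_multilinear (i0 := p)); apply/matrixP => i j.
- by rewrite [LHS]mxE [LHS]mxE E !mxE eqxx !mul1r /index_upd eqxx.
- rewrite [RHS]mxE [RHS]mxE E !mxE (inj_eq (increasing_inj hf)) eq_sym (negPf (neq_lift _ _)).
  by rewrite mul0r mulr0 addr0.
- rewrite [RHS]mxE [RHS]mxE E !mxE (inj_eq (increasing_inj hf)) /index_upd.
  by rewrite eq_sym (negPf (neq_lift _ _)) mul0r mulr0 addr0.
Qed.

Lemma minor_eqrow k (f g : 'I_k -> 'I_n) i j N :
  i != j -> f i = f j -> minor f g N = 0.
Proof.
move=> ij fij; apply: (determinant_alternate ij) => s.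
by rewrite !mxE fij.
Qed.

(** The relation of the matrix [1 + q E_{x,y}] with [q > 0]. A move onto an occupied [y] is ruled
    out only by requiring both maps to be increasing. *)
Definition slide (x y : 'I_n) k (f g : 'I_k -> 'I_n) :=
  forall i, g i = f i \/ f i = x /\ g i = y.

Definition adjacent (x y : 'I_n) := (x == y.+1 :> nat) || (y == x.+1 :> nat).

(** No index lies strictly between [f p] and [y], and [y] is free, so the move cannot jump over
    another value of [f]. *)
Lemma increasing_upd k (f : 'I_k -> 'I_n) p y :
  adjacent (f p) y -> increasing f -> (forall i, f i != y) ->
  increasing (index_upd f p y).
Proof.
rewrite /adjacent => pq hf fy i j ij; rewrite /index_upd.
move: ij (hf i j ij) (fy i) (fy j).
by case: (i =P p) => [->|_]; case: (j =P p) => [->|_]; rewrite -!val_eqE /=; lia.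
Qed.

Lemma planar_addrow (x y : 'I_n) (q : R) : adjacent x y -> 0 < q ->
  planar (1%:M + q *: delta_mx x y) /\ (forall k (f g : 'I_k -> 'I_n),
     increasing f -> increasing g ->
     (0 < minor f g (1%:M + q *: delta_mx x y) <-> slide x y f g)).
Proof.
move=> xy q_gt0; apply: (@planar_of_step _ (slide x y)).
- by move=> k f i; left.
- move=> k f g f' g' fg fg' i; move: (fg i) (fg' i) xy; rewrite /adjacent.
  move=> h h' xy.
  (* By adjacency, a fixed index is at most both of [x] and [y] or at least both. *)
  suff : index_min g g' i = index_min f f' i :> nat \/
      index_min f f' i = x :> nat /\ index_min g g' i = y :> nat.
    by move=> [/val_inj|[/val_inj ? /val_inj ?]]; [left|right].
  rewrite !index_min_val; case: h => [->|[-> ->]]; case: h' => [->|[-> ->]]; lia.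
- move=> k f g f' g' fg fg' i; move: (fg i) (fg' i) xy; rewrite /adjacent.
  move=> h h' xy.
  suff : index_max g g' i = index_max f f' i :> nat \/
      index_max f f' i = x :> nat /\ index_max g g' i = y :> nat.
    by move=> [/val_inj|[/val_inj ? /val_inj ?]]; [left|right].
  rewrite !index_max_val; case: h => [->|[-> ->]]; case: h' => [->|[-> ->]]; lia.
move=> N hN k f g hf hg.
have nomove h : increasing h -> slide x y f h ->
    (forall i, f i = x -> h i != y) -> h = f.
  move=> hh fh nxy; apply/funext => i; have [//|[fx hy]] := fh i.
  by move: (nxy i fx); rewrite hy eqxx.
have [/existsP[p /eqP fp]|/existsPn fx] := boolP [exists p, f p == x]; last first.
  rewrite minor_addrow_notin //; split; first exact: hN.
  split=> [fg|[h [hh fh hg0]]]; first by exists f; split=> // i; left.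
  by rewrite -(nomove h) // => i /eqP; rewrite (negPf (fx i)).
move: fp xy nomove => <- {x} xy nomove; rewrite minor_addrow //.
have [/existsP[s /eqP fs]|/existsPn fy] := boolP [exists s, f s == y].
  (* With [y] occupied, the updated map repeats a row and the second term vanishes. On the
     combinatorial side, moving [p] to [y] would make [h] take the value [y] at both [p] and [s]. *)
  have sp : p != s by apply/eqP => sp; move: xy; rewrite sp fs /adjacent; lia.
  rewrite (@minor_eqrow _ (index_upd f p y) g p s) //; last first.
    by rewrite /index_upd eqxx eq_sym (negPf sp).
  rewrite mulr0 addr0; split; first exact: hN.
  split=> [fg|[h [hh fh hg0]]]; first by exists f; split=> // i; left.
  rewrite -(nomove h) // => i /(increasing_inj hf) ->; apply/eqP => hpy.
  have hsy : h s = y by have [->|[/(increasing_inj hf) sp']] := fh s; rewrite ?fs.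
  by case/eqP: sp; apply: (increasing_inj hh); rewrite hpy hsy.
have hu := increasing_upd xy hf fy.
(* Both terms are nonnegative, so the sum is positive iff one of them is; the first corresponds to
   [h = f], the second to [h = index_upd f p y]. *)
have m1 := hN _ _ _ hf hg; have m2 := hN _ _ _ hu hg.
split; first by rewrite addr_ge0 // mulr_ge0 // ltW.
split.
  have [m1_gt0|] := ltP 0 (minor f g N); first by exists f; split=> // i; left.
  move=> m1_le0; have -> : minor f g N = 0 by apply/le_anti; rewrite m1 m1_le0.
  rewrite add0r pmulr_rgt0 // => m2_gt0; exists (index_upd f p y); split=> // i.
  by rewrite /index_upd; case: eqP => [->|_]; [right|left].
move=> [h [hh fh hg0]].
have [hpy|hpy] := eqVneq (h p) y.
  have hE : h = index_upd f p y.
    apply/funext => i; rewrite /index_upd; case: eqP => [->//|ip].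
    by have [//|[/(increasing_inj hf)]] := fh i.
  by rewrite -hE ltr_wpDl // mulr_gt0.
have hE : h = f by apply: nomove => // i /(increasing_inj hf) ->.
by rewrite hE in hg0; rewrite ltr_pwDl // mulr_ge0 // ltW.
Qed.

(** * Lower and upper triangular factors *)

Definition lowering M := forall k (f g : 'I_k -> 'I_n),
  increasing f -> increasing g -> 0 < minor f g M -> index_le g f.

Definition raising M := forall k (f g : 'I_k -> 'I_n),
  increasing f -> increasing g -> 0 < minor f g M -> index_le f g.

Definition planar_lower M := planar M /\ lowering M.
Definition planar_upper M := planar M /\ raising M.

Lemma planar_lower_diag (d : 'rV[R]_n) :
  (forall i, 0 < d 0 i) -> planar_lower (diag_mx d).
Proof.
by case/planar_diag => hd E; split=> // k f g hf hg /E-/(_ hf hg) -> i.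
Qed.

Lemma planar_upper_diag (d : 'rV[R]_n) :
  (forall i, 0 < d 0 i) -> planar_upper (diag_mx d).
Proof.
by case/planar_diag => hd E; split=> // k f g hf hg /E-/(_ hf hg) -> i.
Qed.

Lemma planar_lower_1 : planar_lower 1%:M.
Proof. by rewrite -diag_const_mx; apply: planar_lower_diag => i; rewrite mxE. Qed.

Lemma planar_upper_1 : planar_upper 1%:M.
Proof. by rewrite -diag_const_mx; apply: planar_upper_diag => i; rewrite mxE. Qed.

Lemma planar_lower_mulmx M N :
  planar_lower M -> planar_lower N -> planar_lower (M *m N).
Proof.
move=> [hM lM] [hN lN]; split; first exact: planar_mulmx.
move=> k f g hf hg /(planar_mul hM (planar_ge0 hN) hf hg)[h [hh fh hg0]] i.
by apply: leq_trans (lN _ _ _ hh hg hg0 i) (lM _ _ _ hf hh fh i).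
Qed.

Lemma planar_upper_mulmx M N :
  planar_upper M -> planar_upper N -> planar_upper (M *m N).
Proof.
move=> [hM lM] [hN lN]; split; first exact: planar_mulmx.
move=> k f g hf hg /(planar_mul hM (planar_ge0 hN) hf hg)[h [hh fh hg0]] i.
by apply: leq_trans (lM _ _ _ hf hh fh i) (lN _ _ _ hh hg hg0 i).
Qed.

Lemma planar_lower_addrow (x y : 'I_n) (q : R) :
  x = y.+1 :> nat -> 0 <= q -> planar_lower (1%:M + q *: delta_mx x y).
Proof.
(* A zero multiplier gives the identity; only a positive one allows slides. *)
move=> xy; rewrite le_eqVlt => /orP[/eqP<-|q_gt0].
  by rewrite scale0r addr0; exact: planar_lower_1.
have [|hE E] := @planar_addrow x y q _ q_gt0; first by rewrite /adjacent xy eqxx.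
split=> // k f g hf hg /E-/(_ hf hg) fg i.
by have [->//|[-> ->]] := fg i; rewrite xy.
Qed.

Lemma planar_upper_addrow (x y : 'I_n) (q : R) :
  y = x.+1 :> nat -> 0 <= q -> planar_upper (1%:M + q *: delta_mx x y).
Proof.
move=> xy; rewrite le_eqVlt => /orP[/eqP<-|q_gt0].
  by rewrite scale0r addr0; exact: planar_upper_1.
have [|hE E] := @planar_addrow x y q _ q_gt0.
  by rewrite /adjacent xy eqxx orbT.
split=> // k f g hf hg /E-/(_ hf hg) fg i.
by have [->//|[-> ->]] := fg i; rewrite xy.
Qed.

(* The indices x and y are 0-based, those of L_mx and U_mx 1-based. *)
Lemma L_mxE j (q : R) : (2 <= j <= n)%N ->
  exists x y : 'I_n, x = y.+1 :> nat /\ L_mx n j q = 1%:M + q *: delta_mx x y.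
Proof.
case/andP=> j2 jn; have hx : (j.-1 < n)%N by lia.
have hy : (j.-2 < n)%N by lia.
exists (Ordinal hx), (Ordinal hy); split=> /=; first lia.
rewrite /L_mx; congr (_ + _ *: _); apply/matrixP => r s; rewrite !mxE -!val_eqE /=.
by congr (_ _)%:R; lia.
Qed.

Lemma planar_lower_L j (q : R) :
  (2 <= j <= n)%N -> 0 <= q -> planar_lower (L_mx n j q).
Proof. by move=> /(L_mxE q)[x [y [xy ->]]]; exact: planar_lower_addrow. Qed.

Lemma planar_upper_U j (q : R) :
  (2 <= j <= n)%N -> 0 <= q -> planar_upper (U_mx n j q).
Proof.
rewrite /U_mx => /(L_mxE q)[x [y [xy ->]]].
rewrite linearD linearZ /= trmx1 trmx_delta; exact: planar_upper_addrow.
Qed.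

Lemma planar_lower_SEB (a : nat -> nat -> R) :
  (forall i j, (2 <= i)%N -> (i <= j)%N -> (j <= n)%N -> 0 <= a i j) ->
  planar_lower (SEB_lower n a).
Proof.
move=> a0; rewrite /SEB_lower big_seq.
apply: (big_ind planar_lower planar_lower_1 planar_lower_mulmx) => i.
rewrite mem_index_iota => /andP[i2 _]; rewrite /W_mx big_seq.
apply: (big_ind planar_lower planar_lower_1 planar_lower_mulmx) => j.
rewrite mem_rev mem_index_iota => /andP[ij jn].
by apply: planar_lower_L; [lia|apply: a0; lia].
Qed.

Lemma planar_upper_SEB (b : nat -> nat -> R) :
  (forall i j, (2 <= i)%N -> (i <= j)%N -> (j <= n)%N -> 0 <= b i j) ->
  planar_upper (SEB_upper n b).
Proof.
move=> b0; rewrite /SEB_upper big_seq.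
apply: (big_ind planar_upper planar_upper_1 planar_upper_mulmx) => i.
rewrite mem_rev mem_index_iota => /andP[i2 _]; rewrite /Q_mx big_seq.
apply: (big_ind planar_upper planar_upper_1 planar_upper_mulmx) => j.
rewrite mem_index_iota => /andP[ij jn].
by apply: planar_upper_U; [lia|apply: b0; lia].
Qed.

(** * Corner minors and total positivity *)

Lemma increasing_first c (hc : (c <= n)%N) : increasing (first_ord hc).
Proof. by []. Qed.

Lemma increasing_last c (hc : (c <= n)%N) : increasing (last_ord hc).
Proof. by move=> i j ij /=; rewrite ltn_add2l. Qed.

Lemma first_ord_le c (hc : (c <= n)%N) f :
  increasing f -> index_le (first_ord hc) f.
Proof. by move=> hf i; exact: (increasing_ge_id i hf). Qed.

Lemma le_last_ord c (hc : (c <= n)%N) f :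
  increasing f -> index_le f (last_ord hc).
Proof. by move=> hf i; have /= := increasing_le_last i hf; lia. Qed.

Lemma increasing_leq c (f : 'I_c -> 'I_n) : increasing f -> (c <= n)%N.
Proof. by move=> /increasing_inj/leq_card; rewrite !card_ord. Qed.

Lemma last_ord_full (hn : (n <= n)%N) : last_ord hn = first_ord hn.
Proof. by apply/funext => i; apply/val_inj => /=; lia. Qed.

Lemma planar_corners_totally_positive M : planar M ->
  (forall c (hc : (c <= n)%N), (0 < c < n)%N -> 0 < lower_left_minor hc M) ->
  (forall c (hc : (c <= n)%N), (0 < c < n)%N -> 0 < upper_right_minor hc M) ->
  totally_positive M.
Proof.
move=> hM hl hu c f g c_gt0 hf hg.
have hc := increasing_leq hf.
have hF := @increasing_first _ hc; have hL := @increasing_last _ hc.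
have [LF FL] : 0 < minor (last_ord hc) (first_ord hc) M /\
    0 < minor (first_ord hc) (last_ord hc) M.
  have [cn|] := ltnP c n; first by split; [apply: hl|apply: hu]; rewrite c_gt0.
  (* For [c = n] both corners are the determinant, a principal minor, hence positive by
     reflexivity. *)
  rewrite leq_eqVlt ltnNge hc orbF => /eqP cn.
  case: _ / cn in hM hl hu f g hf hg c_gt0 hc hF hL *.
  by rewrite last_ord_full; split; exact: planar_refl.
have fL : 0 < minor f (last_ord hc) M.
  have := planar_max hM hF hL hf hf FL (planar_refl hM hf).
  by rewrite index_max_r ?index_max_l //; [exact: le_last_ord|exact: first_ord_le].
have Lg : 0 < minor (last_ord hc) g M.
  have := planar_max hM hL hF hg hg LF (planar_refl hM hg).
  by rewrite index_max_l ?index_max_r //; [exact: first_ord_le|exact: le_last_ord].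
have := planar_min hM hf hL hL hg fL Lg.
by rewrite index_min_l ?index_min_r //; exact: le_last_ord.
Qed.

(** * Corner minors of powers of a product *)

(** A chain of alternating steps of [M] and [N] is shadowed from below by steps of [M] alone. The
    minimum of [f -> s] and [f' -> f'] is a step from [f'] to [index_min s f']; as [N] only raises
    [s] to [h], the new map is still below [h]. Allowing any start below [f] is what makes the
    induction go through. *)
Lemma minor_exp_lower M N k c (f g f' : 'I_c -> 'I_n) :
  planar M -> planar_upper N ->
  increasing f -> increasing g -> increasing f' -> index_le f' f ->
  0 < minor f g ((M *m N) ^+ k) ->
  exists g', [/\ increasing g', index_le g' g & 0 < minor f' g' (M ^+ k)].
Proof.
move=> hM [hN rN]; elim: k f g f' => [|k IHk] f g f' hf hg hf' ff' fg.
  have {}fg : f = g by apply: minor_1_neq0 => //; exact: lt0r_neq0.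
  by exists f'; rewrite -fg expr0 minor_1_refl.
have hMN := planar_mulmx hM hN.
move: fg; rewrite exprS => /(planar_mul hMN (planar_ge0 (planar_exp k hMN)) hf hg).
move=> [h [hh /(planar_mul hM (planar_ge0 hN) hf hh)[s [hs fs sh]] hg0]].
have f's : 0 < minor f' (index_min s f') M.
  have := planar_min hM hf hs hf' hf' fs (planar_refl hM hf').
  by rewrite index_min_r.
have hs' := increasing_min hs hf'.
have [|g' [hg' g'g g'M]] := IHk h g (index_min s f') hh hg hs' _ hg0.
  by move=> i; have := rN _ _ _ hs hh sh i; rewrite index_min_val; lia.
exists g'; split=> //; rewrite exprS.
by apply/(planar_mul hM (planar_ge0 (planar_exp k hM))) => //;
  exists (index_min s f').
Qed.

(** The dual shadowing from above: [M] lowers [f] to some [s] below [f'], and the maximum of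
    [s -> h] and [f' -> f'] is a step of [N] from [f'] to [index_max h f']. *)
Lemma minor_exp_upper M N k c (f g f' : 'I_c -> 'I_n) :
  planar_lower M -> planar N ->
  increasing f -> increasing g -> increasing f' -> index_le f f' ->
  0 < minor f g ((M *m N) ^+ k) ->
  exists g', [/\ increasing g', index_le g g' & 0 < minor f' g' (N ^+ k)].
Proof.
move=> [hM lM] hN; elim: k f g f' => [|k IHk] f g f' hf hg hf' ff' fg.
  have {}fg : f = g by apply: minor_1_neq0 => //; exact: lt0r_neq0.
  by exists f'; rewrite -fg expr0 minor_1_refl.
have hMN := planar_mulmx hM hN.
move: fg; rewrite exprS => /(planar_mul hMN (planar_ge0 (planar_exp k hMN)) hf hg).
move=> [h [hh /(planar_mul hM (planar_ge0 hN) hf hh)[s [hs fs sh]] hg0]].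
have f'h : 0 < minor f' (index_max h f') N.
  have := planar_max hN hs hh hf' hf' sh (planar_refl hN hf').
  by rewrite index_max_r // => i; exact: leq_trans (lM _ _ _ hf hs fs i) (ff' i).
have hh' := increasing_max hh hf'.
have [|g' [hg' g'g g'N]] := IHk h g (index_max h f') hh hg hh' _ hg0.
  by move=> i; rewrite index_max_val; lia.
exists g'; split=> //; rewrite exprS.
by apply/(planar_mul hN (planar_ge0 (planar_exp k hN))) => //;
  exists (index_max h f').
Qed.

Lemma lower_left_exp M N k c (hc : (c <= n)%N) :
  planar M -> planar_upper N ->
  0 < lower_left_minor hc ((M *m N) ^+ k) <-> 0 < lower_left_minor hc (M ^+ k).
Proof.
move=> hM hN; have hF := @increasing_first _ hc; have hL := @increasing_last _ hc.
split.
  (* The shadow chain ends below [first_ord], the least increasing map, hence at it. *)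
  move=> /(minor_exp_lower hM hN hL hF hL)[//|g [hg gF]].
  suff -> : g = first_ord hc by [].
  by apply/funext => i; apply/val_inj/eqP; rewrite eqn_leq gF first_ord_le.
rewrite /lower_left_minor.
(* Conversely, each step of [M] is followed by a stationary step of [N]. The induction needs
   arbitrary increasing maps in place of the corners. *)
elim: k (last_ord hc) (first_ord hc) hL hF => [//|k IHk] f g hf hg.
rewrite !exprS.
move=> /(planar_mul hM (planar_ge0 (planar_exp k hM)) hf hg)[h [hh fh hg0]].
have hMN := planar_mulmx hM hN.1.
apply/(planar_mul hMN (planar_ge0 (planar_exp k hMN))) => //; exists h; split=> //.
  apply/(planar_mul hM (planar_ge0 hN.1)) => //; exists h; split=> //.
  exact: planar_refl hN.1 _ _ hh.
exact: IHk.
Qed.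

Lemma upper_right_exp M N k c (hc : (c <= n)%N) :
  planar_lower M -> planar N ->
  0 < upper_right_minor hc ((M *m N) ^+ k) <-> 0 < upper_right_minor hc (N ^+ k).
Proof.
move=> hM hN; have hF := @increasing_first _ hc; have hL := @increasing_last _ hc.
split.
  (* Here the shadow chain ends above the greatest increasing map. *)
  move=> /(minor_exp_upper hM hN hF hL hF)[//|g [hg gF]].
  suff -> : g = last_ord hc by [].
  by apply/funext => i; apply/val_inj/eqP; rewrite eqn_leq gF le_last_ord.
rewrite /upper_right_minor.
(* Each step of [N] is now preceded by a stationary step of [M]. *)
elim: k (first_ord hc) (last_ord hc) hF hL => [//|k IHk] f g hf hg.
rewrite !exprS.
move=> /(planar_mul hN (planar_ge0 (planar_exp k hN)) hf hg)[h [hh fh hg0]].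
have hMN := planar_mulmx hM.1 hN.
apply/(planar_mul hMN (planar_ge0 (planar_exp k hMN))) => //; exists h; split=> //.
  apply/(planar_mul hM.1 (planar_ge0 hN)) => //; exists f; split=> //.
  exact: planar_refl hM.1 _ _ hf.
exact: IHk.
Qed.

(** Stationary steps [f -> f] fill the additional [k - j] factors. *)
Lemma planar_exp_mono M j k c (f g : 'I_c -> 'I_n) : planar M ->
  increasing f -> increasing g -> (j <= k)%N ->
  0 < minor f g (M ^+ j) -> 0 < minor f g (M ^+ k).
Proof.
move=> hM hf hg /subnK <- fg; rewrite exprD.
apply/(planar_mul (planar_exp _ hM) (planar_ge0 (planar_exp j hM))) => //.
by exists f; split=> //; exact: planar_refl (planar_exp _ hM) _ _ hf.
Qed.

End Planar.

(** * Least exponents and the formula for [r(A)] *)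

Lemma ex_least_positive (P : nat -> Prop) k :
  (0 < k)%N -> P k -> exists m, least_positive P m.
Proof.
move=> k_gt0 Pk; pose Q m := (0 < m)%N && `[< P m >].
have exQ : exists m, Q m by exists k; apply/andP; split=> //; exact/asboolP.
case: (ex_minnP exQ) => m /andP[m_gt0 /asboolP Pm] min_m.
exists m; split=> // j j_gt0 Pj; apply: min_m.
by apply/andP; split=> //; exact/asboolP.
Qed.

Theorem theorem2 (R : realType) (n : nat) (A : 'M[R]_n)
    (a : nat -> nat -> R) (d : 'rV[R]_n) (b : nat -> nat -> R)
    (hn : (2 <= n)%N) (hA : oscillatory A)
    (hSEB : SEB_factorization A a d b) :
  exists r rl ru : nat,
    [/\ is_exponent A r,
        is_lower_exponent (SEB_lower n a) rl,
        is_upper_exponent (SEB_upper n b) ru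
      & r = maxn rl ru].
Proof.
case: hSEB => a0 b0 d0 defA.
have hL := planar_lower_SEB a0; have hU := planar_upper_SEB b0.
(* The diagonal joins either side: [L (D U)] serves the lower corners, [(L D) U] the upper ones. *)
have hLD := planar_lower_mulmx hL (planar_lower_diag d0).
have hDU := planar_upper_mulmx (planar_upper_diag d0) hU.
pose Pl k := forall c (hc : (c <= n)%N), (0 < c < n)%N ->
  0 < lower_left_minor hc (SEB_lower n a ^+ k).
pose Pu k := forall c (hc : (c <= n)%N), (0 < c < n)%N ->
  0 < upper_right_minor hc (SEB_upper n b ^+ k).
have TPl k : totally_positive (A ^+ k) -> Pl k.
  move=> TP c hc /andP[c0 _]; apply/(lower_left_exp k hc hL.1 hDU).
  by rewrite mulmxA -defA; apply: TP => //; exact: increasing_last.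
have TPu k : totally_positive (A ^+ k) -> Pu k.
  move=> TP c hc /andP[c0 _]; apply/(upper_right_exp k hc hLD hU.1).
  by rewrite -defA; apply: TP => //; exact: increasing_last.
have TPlu k : Pl k -> Pu k -> totally_positive (A ^+ k).
  move=> Plk Puk; apply: planar_corners_totally_positive.
  - by apply: planar_exp; rewrite defA; exact: planar_mulmx hLD.1 hU.1.
  - move=> c hc c0n; rewrite defA -mulmxA.
    by apply/(lower_left_exp k hc hL.1 hDU); exact: Plk.
  - move=> c hc c0n; rewrite defA.
    by apply/(upper_right_exp k hc hLD hU.1); exact: Puk.
(* A totally positive power of [A] yields both corner conditions at [m], so the least exponents [rl]
   and [ru] exist. *)
case: hA => _ [m [m_gt0 TPm]].
have [rl [rl_gt0 Prl rl_min]] := ex_least_positive m_gt0 (TPl m TPm).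
have [ru [ru_gt0 Pru ru_min]] := ex_least_positive m_gt0 (TPu m TPm).
exists (maxn rl ru), rl, ru; split=> //.
split; first by rewrite leq_max rl_gt0.
  (* Each corner condition persists from its least exponent up to the maximum. *)
  apply: TPlu => c hc c0n.
    apply: (planar_exp_mono hL.1 _ _ (leq_maxl rl ru)) (Prl c hc c0n) => //.
    exact: increasing_last.
  apply: (planar_exp_mono hU.1 _ _ (leq_maxr rl ru)) (Pru c hc c0n) => //.
  exact: increasing_last.
move=> j j_gt0 TPj; rewrite geq_max rl_min ?ru_min //; [exact: TPu|exact: TPl].
Qed.
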